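(* Let $\Sigma,\Delta$ be finite alphabets. If $S$ is a set of marked morphisms from $\Sigma^*$ to $\Delta^*$, then $\operatorname{Eq}(S)$ is a free monoid with $\operatorname{rk}(\operatorname{Eq}(S))\leq|\Sigma|$.
   Context: $\Sigma^*$ is the free monoid on $\Sigma$. A monoid morphism $f:\Sigma^*\to\Delta^*$ is marked if $f(a)$ is a non-empty word for every $a\in\Sigma$ and, for distinct $a,b\in\Sigma$, the words $f(a)$ and $f(b)$ start with different letters of $\Delta$. For morphisms $g,h:\Sigma^*\to\Delta^*$ put $\operatorname{Eq}(g,h)=\{x\in\Sigma^*\mid g(x)=h(x)\}$, and for a set $S$ of morphisms $\Sigma^*\to\Delta^*$ put $\operatorname{Eq}(S)=\bigcap_{g,h\in S}\operatorname{Eq}(g,h)$, a submonoid of $\Sigma^*$. The rank $\operatorname{rk}(M)$ of a free monoid $M$ is the cardinality of its basis (equivalently its minimum number of generators). *)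

(* Defs.v *)
From HB Require Import structures.
From mathcomp Require Import all_boot.
From mathcomp Require Import classical_sets functions cardinality.

Set Implicit Arguments.
Unset Strict Implicit.
Unset Printing Implicit Defensive.

Local Open Scope classical_set_scope.
Local Open Scope group_scope.
Local Open Scope card_scope.

(* An alias of [seq], so that the monoid structure is not put on [seq] itself. *)
Definition word (T : Type) := seq T.

HB.instance Definition _ (T : choiceType) := Choice.on (word T).
HB.instance Definition _ (T : choiceType) :=
  isMonoid.Build (word T) (@catA T) (@cat0s T) (@cats0 T).

Lemma prod_wordE (T : choiceType) (s : seq (word T)) :
  \prod_(w <- s) w = flatten s.
Proof. by elim: s => [|w s IH]; rewrite ?big_nil // big_cons IH. Qed.

Notation word_morphism Sigma Delta :=
  (UMagmaMorphism.type (word Sigma) (word Delta)).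

(* On non-empty words, comparing [ohead]s is comparing first letters. *)
Definition marked (Sigma Delta : choiceType) (f : word_morphism Sigma Delta) :
    Prop :=
  (forall a : Sigma, f [:: a] <> 1) /\
  (forall a b : Sigma, a <> b -> ohead (f [:: a]) <> ohead (f [:: b])).

Definition equaliser (Sigma Delta : choiceType) (g h : word_morphism Sigma Delta) :
    set (word Sigma) :=
  [set x | g x = h x].

(* For S empty this is the whole of Sigma^*. *)
Definition equaliser_set (Sigma Delta : choiceType)
    (S : set (word_morphism Sigma Delta)) : set (word Sigma) :=
  \bigcap_(g in S) \bigcap_(h in S) equaliser g h.

(* The canonical morphism B^* -> Sigma^* is a bijection onto M; in particular
   M is then a submonoid of Sigma^*, and it is isomorphic to B^*. *)
Definition is_basis (T : choiceType) (M B : set (word T)) : Prop :=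
  set_bij [set s : seq (word T) | [set` s] `<=` B] M
          (fun s => \prod_(w <- s) w).

Definition free_monoid (T : choiceType) (M : set (word T)) : Prop :=
  exists B : set (word T), is_basis M B.

Definition has_rank (T : choiceType) (M : set (word T)) (k : nat) : Prop :=
  exists2 B : set (word T), is_basis M B & B #= `I_k.

Section RankUnique.
Variables (T : choiceType) (M : set (word T)).

Let basis_neq1 (B : set (word T)) : is_basis M B -> ~ B 1.
Proof.
case=> _ inj _ B1; suff: [::] = [:: 1] :> seq (word T) by [].
apply: inj; last by rewrite big_nil big_seq1.
- by rewrite inE.
- by rewrite inE => w /=; rewrite inE => /eqP ->.
Qed.

Let basis_sub (B C : set (word T)) : is_basis M B -> is_basis M C -> B `<=` C.
Proof.
move=> bB bC b Bb; have [fB injB surjB] := bB; have [fC injC surjC] := bC.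
have sb : [set` [:: b]] `<=` B by move=> w /=; rewrite inE => /eqP ->.
have := fB _ sb; rewrite /= big_seq1 => /surjC [] [|c s] sC /=.
  by rewrite big_nil => b1; case: (basis_neq1 bB); rewrite b1.
rewrite big_cons => bE.
have Cc : C c by apply: sC; rewrite /= inE eqxx.
have cC : [set` [:: c]] `<=` C by move=> w /=; rewrite inE => /eqP ->.
have sC' : [set` s] `<=` C by move=> w ws; apply: sC; rewrite /= inE ws orbT.
have := fC _ cC; rewrite /= big_seq1 => /surjB [t tB tE].
have /surjB [u uB uE] := fC _ sC'.
have tu : t ++ u = [:: b].
  apply: injB; rewrite ?inE //; last by rewrite big_cat big_seq1 /= tE uE.
  by move=> w /=; rewrite mem_cat => /orP [/tB|/uB].
case: t tE tu {tB} => [|x [|? ?]] /= tE tu; last by case: tu.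
- by rewrite big_nil in tE; case: (basis_neq1 bC); rewrite tE.
- by case: tu tE => -> _; rewrite big_seq1 => ->.
Qed.

Lemma is_basis_unique (B C : set (word T)) :
  is_basis M B -> is_basis M C -> B = C.
Proof. by move=> bB bC; apply/seteqP; split; apply: basis_sub. Qed.

Lemma has_rank_unique (k l : nat) : has_rank M k -> has_rank M l -> k = l.
Proof.
move=> [B bB Bk] [C bC Cl]; apply/card_eq_II.
rewrite -(is_basis_unique bB bC) in Cl; apply: card_eq_trans Cl.
by rewrite card_eq_sym.
Qed.

End RankUnique.

(* Main.v *)
Require Import Defs.
From mathcomp Require Import all_boot.
From mathcomp Require Import classical_sets functions cardinality.
From mathcomp Require Import boolp.

(** Cancellation in [Delta^*] shows that [y] lies in [Eq(S)] as soon as [u] and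
    [u ++ y] do.  A submonoid with this property is free: its non-empty members
    without proper non-empty prefix in the submonoid form a prefix code, which
    generates it ([unitary_is_basis]).

    For the rank, these atoms have pairwise distinct first letters
    ([equaliser_atoms_ohead_inj]).  Suppose that two distinct atoms share their
    first letter, and let [w] be their longest common prefix.  Then [w] is
    non-empty and a proper prefix of both, hence is not in [Eq(S)], and some
    [g], [h] in [S] have [g w <> h w].  As both atoms equalise [g] and [h], one
    of the words [g w], [h w] is a strict prefix of the other; if [h w] is the
    shorter one, then the letter of [g w] that follows [h w] is the first letter
    of the [h]-image of whichever letter comes after [w].  Since [h] is marked,
    that letter is the same in both atoms, against the choice of [w]. *)

Set Implicit Arguments.
Unset Strict Implicit.
Unset Printing Implicit Defensive.

Local Open Scope classical_set_scope.
Local Open Scope card_scope.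

(** * Free submonoids from left cancellation *)

Lemma prefix_or_diverge (T : eqType) (x y : seq T) :
  [\/ prefix x y, prefix y x |
    exists w a b x' y', [/\ x = w ++ a :: x', y = w ++ b :: y' & a <> b]].
Proof.
elim: x y => [|a x IH] [|b y]; try by [constructor 1 | constructor 2].
have [<-|ab] := eqVneq a b; last first.
  by constructor 3; exists [::], a, b, x, y; split=> //; apply/eqP.
rewrite /= eqxx; case: (IH y) => [xy|yx|].
- by constructor 1.
- by constructor 2.
- move=> [w [c [d [x' [y' [-> -> cd]]]]]].
  by constructor 3; exists (a :: w), c, d, x', y'.
Qed.

Definition atoms (T : choiceType) (M : set (word T)) : set (word T) :=
  [set x | [/\ M x, x <> [::] &
    forall u : word T, prefix u x -> M u -> u = [::] \/ u = x]].

Lemma atoms_prefix_eq (T : choiceType) (M : set (word T)) (x y : word T) :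
  atoms M x -> atoms M y -> prefix x y -> x = y.
Proof. by move=> [Mx x0 _] [_ _ ymin] /ymin /(_ Mx) []. Qed.

(** Two prefixes of one word are comparable, so this is what makes the atoms a
    code. *)
Lemma atoms_cat_eq (T : choiceType) (M : set (word T)) (x y s t : word T) :
  atoms M x -> atoms M y -> x ++ s = y ++ t -> x = y.
Proof.
move=> ax ay; case: (prefix_or_diverge x y) => [|/(atoms_prefix_eq ay ax)//|].
  by move=> /(atoms_prefix_eq ax ay).
move=> [w [a [b [x' [y' [-> -> ab]]]]]] /eqP.
by rewrite -!catA eqseq_cat // => /andP[_ /eqP[]].
Qed.

(** The shortest non-empty prefix of [x] lying in [M] is an atom. *)
Lemma atom_prefix (T : choiceType) (M : set (word T)) (x : word T) :
  M x -> x <> [::] -> exists2 u, atoms M u & prefix u x.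
Proof.
move=> Mx x0; have ex : exists n, `[< M (take n x) >] && (0 < n).
  by exists (size x); rewrite take_size lt0n size_eq0; apply/andP; split;
    [exact/asboolP | exact/eqP].
have [n /andP[/asboolP Mn n0] nmin] := ex_minnP ex.
exists (take n x); last exact: prefix_take.
split=> // [/eqP|u].
  by rewrite -size_eq0 size_take_min -leqn0 geq_min !leqn0 size_eq0 (gtn_eqF n0)
    => /eqP.
rewrite prefixE => /eqP uE Mu; have [/eqP|u0] := posnP (size u).
  by rewrite size_eq0 => /eqP; left.
have un : size u <= n.
  by rewrite -uE size_take_min (leq_trans (geq_minr _ _)) // size_take_min geq_minl.
move: uE; rewrite take_takel // => uE; right.
have nu : n <= size u by apply: nmin; rewrite uE u0 andbT; apply/asboolP.
by rewrite -[LHS]uE; congr take; apply/eqP; rewrite eqn_leq un.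
Qed.

(** Factorisations are unique because the atoms form a prefix code.  They exist
    because the last hypothesis allows an atom to be split off the front of a
    word of [M] while the remainder stays in [M]. *)
Lemma unitary_is_basis (T : choiceType) (M : set (word T)) :
    M [::] -> (forall x y, M x -> M y -> M (x ++ y)) ->
    (forall x y, M x -> M (x ++ y) -> M y) ->
  is_basis M (atoms M).
Proof.
move=> M0 Mcat Mcan; split.
- move=> s /=; rewrite prod_wordE; elim: s => [|x s IH] //= sA.
  apply: Mcat; first by have [] := sA x (mem_head _ _).
  by apply: IH => y ys; apply: sA; rewrite /= inE ys orbT.
- move=> s t; rewrite !inE /= !prod_wordE.
  elim: s t => [|x s IH] [|y t] //=.
  + by move=> _ /(_ y (mem_head _ _)) [_ y0 _]; case: (y) y0.
  + by move=> /(_ x (mem_head _ _)) [_ x0 _] _; case: (x) x0.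
  move=> sA tA E; have xy : x = y.
    exact: atoms_cat_eq (sA x (mem_head _ _)) (tA y (mem_head _ _)) E.
  rewrite xy; congr cons; apply: IH.
  + by move=> z zs; apply: sA; rewrite /= inE zs orbT.
  + by move=> z zt; apply: tA; rewrite /= inE zt orbT.
  + by move/eqP: E; rewrite xy eqseq_cat // eqxx => /eqP.
- move=> x; have [n] := ubnP (size x); elim: n x => // n IH x lexn Mx.
  have [->|/eqP x0] := eqVneq x [::]; first by exists [::]; rewrite ?big_nil.
  have [u au /prefixP[v xE]] := atom_prefix Mx x0.
  have [Mu u0 _] := au.
  have Mv : M v by apply: (Mcan u) => //; rewrite -xE.
  have [|s sA sE] := IH v _ Mv.
    rewrite -ltnS (leq_trans _ lexn) // ltnS xE size_cat.
    by case: (u) u0 => // ? ? _; rewrite addSn ltnS leq_addl.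
  exists (u :: s); last by rewrite big_cons sE xE.
  by move=> z /=; rewrite inE => /orP[/eqP->|/sA].
Qed.

(** * Equalisers of marked morphisms *)

Section Equaliser.
Variables (Sigma Delta : choiceType).
Implicit Types (g h : word_morphism Sigma Delta) (x y w : word Sigma).

Lemma morph_nil h : h [::] = [::].
Proof. exact: (gmulf1 (s := h)). Qed.

Lemma morph_cat h x y : h (x ++ y) = h x ++ h y.
Proof. exact: (gmulfM (s := h)). Qed.

(** Both sides are the letter at position [size (h w)] of the common image: it
    falls inside [g w] on one side, and at the start of [h a] on the other. *)
Lemma ohead_next_image g h w a x :
    h [:: a] <> [::] -> size (h w) < size (g w) ->
    g (w ++ a :: x) = h (w ++ a :: x) ->
  ohead (h [:: a]) = onth (g w) (size (h w)).
Proof.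
move=> ha lt; rewrite morph_cat -(cat1s a) [h _]morph_cat [h (_ ++ _)]morph_cat.
move/(congr1 (fun s => onth s (size (h w)))).
rewrite !onth_cat lt ltnn subnn => ->.
by case: (h [:: a]) ha.
Qed.

(** While [g] and [h] disagree on a prefix, the one that lags behind has to
    catch up, and being marked leaves it a single choice of next letter. *)
Lemma marked_next_letter g h w a b x y :
    marked g -> marked h ->
    g (w ++ a :: x) = h (w ++ a :: x) -> g (w ++ b :: y) = h (w ++ b :: y) ->
  g w <> h w -> a = b.
Proof.
wlog lt : g h / size (h w) < size (g w) => [WL|] mg mh ga gb gw.
  case: (ltngtP (size (h w)) (size (g w))) => [lt|lt|eq_size].
  - exact: (WL g h).
  - by apply: (WL h g) => // E; apply: gw.
  (* Images of equal length that start the same word are equal. *)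
  - case: gw; move/eqP: ga; rewrite !morph_cat eqseq_cat //.
    by move=> /andP[/eqP].
have [h0 hinj] := mh; apply: contrapT => /hinj; apply.
by rewrite (ohead_next_image (h0 a) lt ga) (ohead_next_image (h0 b) lt gb).
Qed.

Variable S : set (word_morphism Sigma Delta).

Lemma equaliser_set_basis : is_basis (equaliser_set S) (atoms (equaliser_set S)).
Proof.
apply: unitary_is_basis.
- by move=> g _ h _; rewrite /equaliser /= !morph_nil.
- move=> x y Ex Ey g Sg h Sh; rewrite /equaliser /= !morph_cat.
  by rewrite (Ex g Sg h Sh) (Ey g Sg h Sh).
- move=> x y Ex Exy g Sg h Sh; have /eqP := Exy g Sg h Sh.
  by rewrite !morph_cat (Ex g Sg h Sh) eqseq_cat // eqxx => /eqP.
Qed.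

Lemma equaliser_atoms_ohead_inj :
    (forall f, S f -> marked f) ->
  {in atoms (equaliser_set S) &, injective (fun x : word Sigma => ohead x)}.
Proof.
move=> mS x y; rewrite !inE => ax ay hxy.
case: (prefix_or_diverge x y) => [|/(atoms_prefix_eq ay ax)//|].
  exact: (atoms_prefix_eq ax ay).
move=> [w [a [b [x' [y' [xE yE ab]]]]]].
(* If [w] were empty, [x] and [y] would start with [a] and [b]. *)
have w0 : w <> [::] by move=> w0; move: hxy; rewrite xE yE w0 => -[].
have [Ex _ xmin] := ax; have [Ey _ _] := ay.
have nEw : ~ equaliser_set S w.
  move=> /(xmin w); rewrite xE prefix_prefix => /(_ isT) [//|].
  by move/(congr1 size)/eqP; rewrite size_cat -{1}[size w]addn0 eqn_add2l.
case: nEw => g Sg h Sh; apply: contrapT => gw; apply: ab.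
apply: (@marked_next_letter g h w a b x' y') => //; try exact: mS.
- by rewrite -xE; apply: Ex.
- by rewrite -yE; apply: Ey.
Qed.

End Equaliser.

(** * The rank bound *)

Lemma ohead_inj_card (Sigma : finType) (B : set (word Sigma)) :
    (forall x, B x -> x <> [::]) ->
    {in B &, injective (fun x : word Sigma => ohead x)} ->
  B #<= `I_#|Sigma|.
Proof.
move=> B0 Binj; have [->|/set0P[[/B0//|a0 x0 _]]] := eqVneq B set0.
  exact: card_ge0.
(* The default letter [a0] is never read, as [B] has no empty word. *)
pose f (x : word Sigma) : nat := enum_rank (head a0 x).
have finj : {in B &, injective f}.
  move=> x y xB yB /ord_inj/enum_rank_inj hxy; apply: Binj => //.
  move: xB yB hxy; rewrite !inE => /B0 + /B0.
  by case: x y => [|a x] [|b y] //= _ _ ->.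
have fB : [set f x | x in B] `<=` `I_#|Sigma|.
  by move=> _ [x _ <-] /=; apply: ltn_ord.
by rewrite -(card_le_eql (inj_card_eq finj)); apply: subset_card_le.
Qed.

Theorem corollary6 (Sigma Delta : finType)
    (S : set (word_morphism Sigma Delta))
    (S_marked : forall f, S f -> marked f) :
  free_monoid (equaliser_set S) /\
  exists k : nat, has_rank (equaliser_set S) k /\ (k <= #|Sigma|)%N.
Proof.
have basis := equaliser_set_basis S; split; first by eexists; exact: basis.
have le : atoms (equaliser_set S) #<= `I_#|Sigma|.
  apply: ohead_inj_card; first by move=> x [].
  exact: equaliser_atoms_ohead_inj.
have [k Bk] := card_le_finite le (finite_II _).
exists k; split; first by exists (atoms (equaliser_set S)).
by rewrite -card_le_II -(card_le_eql Bk).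
Qed.
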